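(* Let $\alpha,\beta\in\mathbb R$. On the space of Laurent polynomials $f(z)$ consider the operators $$(M_1f)(z)=f(1/z),\qquad (M_2f)(z)=z f(1/z),$$ $$\mathcal K=z\,\partial_z+\frac{z\left((\alpha+\beta+1)z+\alpha-\beta\right)}{1-z^2}\,(M_1-\mathcal I).$$ Then these operators realize the circle Jacobi algebra, that is, $M_1^2=M_2^2=\mathcal I$ and $$\{\mathcal K,M_1\}=(\alpha+\beta+1)(M_1-\mathcal I),\qquad \{\mathcal K,M_2\}=(\alpha+\beta+2)M_2+(\alpha-\beta)\mathcal I.$$
   Context: $\{X,Y\}=XY+YX$ denotes the anticommutator and $\mathcal I$ the identity operator. For a Laurent polynomial $f$, the difference $f(1/z)-f(z)$ is divisible by $1-z^2$ in the ring of Laurent polynomials, so $\mathcal K$ maps Laurent polynomials to Laurent polynomials. *)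

(* Defs.v *)
From HB Require Import structures.
From mathcomp Require Import all_boot all_order all_algebra.
From mathcomp Require Import finmap reals complex.
From mathcomp.multinomials Require Import monalg.
From mathcomp Require Import zify.

Set Implicit Arguments.
Unset Strict Implicit.
Unset Printing Implicit Defensive.

Import GRing.Theory.

Local Open Scope ring_scope.

(* The free C-module on the symbols z^k (k : int), i.e. the finitely supported
   coefficient families. [monalg] only provides a product for monoids without
   nontrivial units, hence the alias and the ring structure below. *)
Definition laurent (C : comNzRingType) : Type := {malg C[int]}.

HB.instance Definition _ (C : comNzRingType) :=
  GRing.Lmodule.copy (laurent C) {malg C[int]}.

(* z^k *)
Definition lmon (C : comNzRingType) (k : int) : laurent C := mkmalgU k 1.

(* the C-linear map sending z^k to u k *)
HB.lock Definition lext (C : comNzRingType) (V : lmodType C) (u : int -> V)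
    (f : laurent C) : V :=
  \sum_(k <- msupp f) mcoeff k f *: u k.

HB.lock Definition lmul (C : comNzRingType) (f g : laurent C) : laurent C :=
  lext (fun i => lext (fun j => lmon C (i + j)) g) f.
Arguments lmul {C} f g.

Section LaurentRing.
Variable C : comNzRingType.
Implicit Types (f g h : laurent C) (k : int).

Local Notation lmon := (lmon C).

Lemma lext_supp (V : lmodType C) (u : int -> V) (s : seq int) f :
  uniq s -> {subset msupp f <= s} ->
  lext u f = \sum_(k <- s) mcoeff k f *: u k.
Proof.
move=> us sub; rewrite lext.unlock [RHS](bigID (fun k => k \in msupp f)) /=.
rewrite [X in _ + X]big1 ?addr0; last first.
  by move=> k kN; rewrite (mcoeff_outdom kN) scale0r.
rewrite -[RHS]big_filter; apply: perm_big; apply: uniq_perm.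
- exact: fset_uniq.
- exact: filter_uniq.
by move=> k; rewrite mem_filter; case: (boolP (k \in msupp f)) => // /sub ->.
Qed.

Lemma lext_is_linear (V : lmodType C) (u : int -> V) : linear (lext u).
Proof.
move=> a f g.
pose s := undup ((msupp f : seq int) ++ (msupp g : seq int)
                 ++ (msupp (a *: f + g : laurent C) : seq int)).
have sf : {subset msupp f <= s}.
  by move=> k kf; rewrite mem_undup !mem_cat kf.
have sg : {subset msupp g <= s}.
  by move=> k kf; rewrite mem_undup !mem_cat kf orbT.
have sfg : {subset msupp (a *: f + g : laurent C) <= s}.
  by move=> k kf; rewrite mem_undup !mem_cat kf !orbT.
rewrite !(@lext_supp _ _ s) ?undup_uniq // scaler_sumr -big_split /=.
apply: eq_bigr => k _.
have -> : mcoeff k (a *: f + g : {malg C[int]}) = a * mcoeff k f + mcoeff k g.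
  by rewrite mcoeffD mcoeffZ.
by rewrite scalerDl scalerA.
Qed.

HB.instance Definition _ (V : lmodType C) (u : int -> V) :=
  GRing.isLinear.Build C (laurent C) V _ (lext u) (lext_is_linear u).

Lemma lext_mon (V : lmodType C) (u : int -> V) k : lext u (lmon k) = u k.
Proof.
rewrite (@lext_supp _ _ [:: k]) //; last first.
  by move=> j; rewrite /lmon msuppU oner_eq0 in_fset1 inE.
by rewrite big_seq1 mcoeffUU scale1r.
Qed.

Lemma laurentE f : f = \sum_(k <- msupp f) mcoeff k f *: lmon k.
Proof.
rewrite [LHS]monalgE; apply: eq_bigr => k _.
by apply/malgP => j; rewrite mcoeffZ !mcoeffU mulrnAr mulr1.
Qed.

Lemma laurent_ext (V : lmodType C) (u v : {linear laurent C -> V}) :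
  (forall k, u (lmon k) = v (lmon k)) -> u =1 v.
Proof.
move=> uv f; rewrite (laurentE f) !linear_sum; apply: eq_bigr => k _.
by rewrite !linearZ uv.
Qed.

Lemma lext_comb (V : lmodType C) (a : C) (u v w : int -> V) f :
  (forall k, w k = a *: u k + v k) -> lext w f = a *: lext u f + lext v f.
Proof.
move=> wE; rewrite lext.unlock scaler_sumr -big_split; apply: eq_bigr => k _ /=.
by rewrite wE scalerDr !scalerA mulrC.
Qed.

Definition lmulr (g f : laurent C) : laurent C := lmul f g.

Fact lmul_linear_l g : linear (lmulr g).
Proof. by move=> a f1 f2; rewrite /lmulr lmul.unlock linearP. Qed.

Fact lmul_linear_r f : linear (lmul f).
Proof.
move=> a g1 g2; rewrite lmul.unlock; apply: lext_comb => k; exact: linearP.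
Qed.

HB.instance Definition _ g :=
  GRing.isLinear.Build C (laurent C) (laurent C) _ (lmulr g)
    (lmul_linear_l g).
HB.instance Definition _ f :=
  GRing.isLinear.Build C (laurent C) (laurent C) _ (lmul f) (lmul_linear_r f).

Fact lmul_mon i j : lmul (lmon i) (lmon j) = lmon (i + j).
Proof. by rewrite lmul.unlock !lext_mon. Qed.

Fact lmulC : commutative (@lmul C).
Proof.
move=> f g; apply: (@laurent_ext _ (lmulr g) (lmul g)) => {f} i /=.
apply: (@laurent_ext _ (lmul (lmon i)) (lmulr (lmon i))) => {g} j /=.
by rewrite /lmulr !lmul_mon addrC.
Qed.

Fact lmulA : associative (@lmul C).
Proof.
move=> f g h.
apply: (@laurent_ext _ (lmulr (lmul g h)) (lmulr h \o lmulr g)) => {f} i /=.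
apply: (@laurent_ext _ (lmul (lmon i) \o lmulr h)
  (lmulr h \o lmul (lmon i))) => {g} j /=.
apply: (@laurent_ext _ (lmul (lmon i) \o lmul (lmon j))
  (lmul (lmul (lmon i) (lmon j)))) => {h} k /=.
by rewrite /lmulr !lmul_mon addrA.
Qed.

Fact lmul1 : left_id (lmon 0) (@lmul C).
Proof.
move=> f; apply: (@laurent_ext _ (lmul (lmon 0)) idfun) => {f} i /=.
by rewrite lmul_mon add0r.
Qed.

Fact lmulDl : left_distributive (@lmul C) +%R.
Proof. by move=> f g h; apply: (linearD (lmulr h)). Qed.

Fact lmon0_neq0 : lmon 0 != 0.
Proof. by rewrite monalgU_eq0 oner_eq0. Qed.

HB.instance Definition _ := GRing.Zmodule_isComNzRing.Build (laurent C)
  lmulA lmulC lmul1 lmulDl lmon0_neq0.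

Fact lmulZAl (a : C) f g : a *: (f * g) = (a *: f) * g.
Proof. by rewrite -[RHS]/(lmulr g (a *: f)) linearZ. Qed.

HB.instance Definition _ :=
  GRing.Lmodule_isLalgebra.Build C (laurent C) lmulZAl.

Fact lmulZAr (a : C) f g : a *: (f * g) = f * (a *: g).
Proof. by rewrite [f * g]mulrC lmulZAl mulrC. Qed.

HB.instance Definition _ :=
  GRing.Lalgebra_isAlgebra.Build C (laurent C) lmulZAr.

Lemma lmonD i j : lmon (i + j) = lmon i * lmon j.
Proof. by rewrite -lmul_mon. Qed.

Lemma lmon_0 : lmon 0 = 1.
Proof. by []. Qed.

End LaurentRing.

Section Reflections.
Variable C : comNzRingType.
Implicit Types f g q : laurent C.

Local Notation z := (lmon C 1).

(* z^k |-> k z^(k-1) *)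
Definition lderiv (f : laurent C) : laurent C :=
  lext (fun k => k%:~R *: lmon C (k - 1)) f.

(* f(1/z), i.e. z^k |-> z^(-k) *)
Definition M1 (f : laurent C) : laurent C := lext (fun k => lmon C (- k)) f.

Definition M2 (f : laurent C) : laurent C := z * M1 f.

Fact M1_linear : linear M1.
Proof. by move=> c f g; rewrite /M1 linearP. Qed.

Fact M2_linear : linear M2.
Proof. by move=> c f g; rewrite /M2 M1_linear mulrDr -scalerAr. Qed.

Fact lderiv_linear : linear lderiv.
Proof. by move=> c f g; rewrite /lderiv linearP. Qed.

HB.instance Definition _ :=
  GRing.isLinear.Build C (laurent C) (laurent C) _ M1 M1_linear.
HB.instance Definition _ :=
  GRing.isLinear.Build C (laurent C) (laurent C) _ M2 M2_linear.
HB.instance Definition _ :=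
  GRing.isLinear.Build C (laurent C) (laurent C) _ lderiv lderiv_linear.

Lemma M1_sub_dvd f : exists q, (1 - z ^+ 2) * q == M1 f - f.
Proof.
have pos n : exists q, (1 - z ^+ 2) * q = lmon C (- n%:Z) - lmon C n%:Z.
  exists (lmon C (- n%:Z) * \sum_(i < n) (z ^+ 2) ^+ i).
  rewrite mulrCA -[1 - _]opprB mulNr -subrX1 opprB mulrBr mulr1.
  congr (_ - _); rewrite -exprM mul2n -addnn.
  have zX m : z ^+ m = lmon C m%:Z.
    by elim: m => // m IH; rewrite exprS IH -lmonD -intS.
  by rewrite zX -lmonD PoszD addKr.
have mon k : exists q, (1 - z ^+ 2) * q = lmon C (- k) - lmon C k.
  have [|n|n] := intP k; first by exists 0; rewrite mulr0 oppr0 subrr.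
  - exact: pos.
  - have [q Eq] := pos n.+1; exists (- q).
    by rewrite mulrN Eq opprB opprK.
suff [q Eq] : exists q, (1 - z ^+ 2) * q = M1 f - f by exists q; apply/eqP.
rewrite {2}(laurentE f) /M1 lext.unlock -sumrB.
elim: (enum_fset (msupp f)) => [|k s [q Eq]].
  by exists 0; rewrite big_nil mulr0.
have [p Ep] := mon k; exists (mcoeff k f *: p + q).
by rewrite big_cons mulrDr Eq -scalerAr Ep scalerBr.
Qed.

End Reflections.

(* (f(1/z) - f(z)) / (1 - z^2); see [M1_quotE], [M1_quot_unique] *)
HB.lock Definition M1_quot (C : comNzRingType) (f : laurent C) : laurent C :=
  xchoose (M1_sub_dvd f).

Section CircleJacobi.
Variable C : comNzRingType.
Implicit Types f g q : laurent C.

Local Notation z := (lmon C 1).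

Lemma M1_quotE f : (1 - z ^+ 2) * M1_quot f = M1 f - f.
Proof. by rewrite M1_quot.unlock; apply/eqP/(xchooseP (M1_sub_dvd f)). Qed.

Lemma mcoeff_lmonM k j f : mcoeff j (lmon C k * f) = mcoeff (j - k) f.
Proof.
rewrite {1}(laurentE f) mulr_sumr [in RHS](laurentE f) !raddf_sum /=.
apply: eq_bigr => i _; rewrite -scalerAr -lmonD !mcoeffZ !mcoeffU.
by rewrite -subr_eq0 -[i == _]subr_eq0 opprB addrCA addrA.
Qed.

Lemma lreg_1subz2 : GRing.lreg (1 - z ^+ 2 : laurent C).
Proof.
apply: mulrI0_lreg => f.
rewrite mulrBl mul1r expr2 -lmonD => /eqP; rewrite subr_eq0 => /eqP fE.
have step k : (k + 2 \in msupp f) = (k \in msupp f).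
  by rewrite -!mcoeff_neq0 {1}fE mcoeff_lmonM addrK.
have steps k n : (k + n%:Z *+ 2 \in msupp f) = (k \in msupp f).
  elim: n => [|n IH]; first by rewrite mul0rn addr0.
  by rewrite -IH -[RHS]step intS mulrnDl [_ *+ 2 + _]addrC addrA.
have [f0|/fset0Pn [k kf]] := eqVneq (msupp f) fset0.
  by apply/malgP => k; rewrite mcoeff0 mcoeff_outdom // f0.
pose s := [seq k + n%:Z *+ 2 | n <- iota 0 #|` msupp f|.+1].
have us : uniq s.
  rewrite map_inj_uniq ?iota_uniq // => m n /addrI.
  by rewrite !mulr2n -!PoszD => -[]; lia.
have ss : {subset s <= msupp f} by move=> _ /mapP [n _ ->]; rewrite steps.
by have := uniq_leq_size us ss; rewrite size_map size_iota ltnn.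
Qed.

Lemma M1_quot_unique f q :
  (1 - z ^+ 2) * q = M1 f - f -> q = M1_quot f.
Proof. by rewrite -M1_quotE => /lreg_1subz2. Qed.

(* z d/dz + A(z) (M1 - I), where A(z) = z((a + b + 1)z + a - b)/(1 - z^2); the
   denominator is cleared by the exact quotient of (M1 - I) f. *)
Definition Kop (a b : C) (f : laurent C) : laurent C :=
  z * lderiv f + z * ((a + b + 1) *: z + (a - b)%:A) * M1_quot f.

Fact M1_quot_linear : linear (@M1_quot C).
Proof.
move=> c f g; apply/esym/M1_quot_unique.
by rewrite mulrDr -scalerAr !M1_quotE M1_linear scalerBr opprD addrACA.
Qed.

Fact Kop_linear a b : linear (Kop a b).
Proof.
move=> c f g; rewrite /Kop lderiv_linear M1_quot_linear !mulrDr -!scalerAr.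
by rewrite scalerDr addrACA.
Qed.

HB.instance Definition _ a b :=
  GRing.isLinear.Build C (laurent C) (laurent C) _ (Kop a b) (Kop_linear a b).

End CircleJacobi.

Definition anticomm (V : zmodType) (X Y : V -> V) (v : V) : V :=
  X (Y v) + Y (X v).

(* Main.v *)
Require Import Defs.
From HB Require Import structures.
From mathcomp Require Import all_boot all_order all_algebra.
From mathcomp Require Import reals complex.
From mathcomp Require Import ring.

Import GRing.Theory.

Local Open Scope ring_scope.
Local Open Scope complex_scope.

(** The reflection f(z) |-> f(1/z) is an involutive ring automorphism, and it
    anticommutes with the Euler operator z d/dz. Hence the divided difference
    q f = (f(1/z) - f(z)) / (1 - z^2) satisfies q (M1 f) = - q f,
    M1 (q f) = z^2 q f and q (M2 f) = z^-1 (M1 f - q f); after these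
    substitutions both anticommutators are polynomial identities in z and
    z^-1. *)

Lemma lmon1_lmonN1 (C : comNzRingType) : lmon C 1 * lmon C (-1) = 1.
Proof. by rewrite -lmonD subrr. Qed.

Lemma M1_lmon (C : comNzRingType) (k : int) : M1 (lmon C k) = lmon C (- k).
Proof. by rewrite /M1 lext_mon. Qed.

Lemma M1K (C : comNzRingType) : involutive (@M1 C).
Proof.
move=> f; apply: (@laurent_ext C _ (@M1 C \o @M1 C) idfun) => {f} k /=.
by rewrite !M1_lmon opprK.
Qed.

(** Both sides are bilinear, so fixing one factor at a time reduces the claim to monomials, where it
    is additivity of negation on exponents. *)
Lemma M1_mul (C : comNzRingType) (f g : laurent C) :
  M1 (f * g) = M1 f * M1 g.
Proof.
apply: (@laurent_ext C _ (@M1 C \o lmulr g) (lmulr (M1 g) \o @M1 C)) => {f} i /=.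
apply: (@laurent_ext C _ (@M1 C \o lmul (lmon C i))
  (lmul (M1 (lmon C i)) \o @M1 C)) => {g} j /=.
by rewrite !M1_lmon !lmul_mon M1_lmon opprD.
Qed.

Lemma M1_alg (C : comNzRingType) (c : C) : M1 (c%:A : laurent C) = c%:A.
Proof. by rewrite linearZ /= -lmon_0 M1_lmon oppr0. Qed.

Lemma M2K (C : comNzRingType) : involutive (@M2 C).
Proof.
by move=> f; rewrite /M2 M1_mul M1K M1_lmon mulrA lmon1_lmonN1 mul1r.
Qed.

Definition euler (C : comNzRingType) (f : laurent C) : laurent C :=
  lmon C 1 * lderiv f.

Fact euler_linear (C : comNzRingType) : linear (@euler C).
Proof. by move=> c f g; rewrite /euler linearP mulrDr -scalerAr. Qed.

HB.instance Definition _ (C : comNzRingType) :=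
  GRing.isLinear.Build C (laurent C) (laurent C) _ (@euler C)
    (@euler_linear C).

Lemma euler_lmon (C : comNzRingType) (k : int) :
  euler C (lmon C k) = k%:~R *: lmon C k.
Proof. by rewrite /euler /lderiv lext_mon -scalerAr -lmonD addrC subrK. Qed.

(** [M1] swaps the Euler eigenvectors z^k and z^-k, whose eigenvalues are opposite. *)
Lemma euler_M1 (C : comNzRingType) (f : laurent C) :
  euler C (M1 f) = - M1 (euler C f).
Proof.
apply: (@laurent_ext C _ (euler C \o @M1 C) (-%R \o (@M1 C \o euler C))) => {f} k /=.
by rewrite euler_lmon linearZ /= !M1_lmon euler_lmon mulrNz scaleNr.
Qed.

(** Leibniz rule for z d/dz, in which z itself has eigenvalue 1. *)
Lemma euler_lmon1M (C : comNzRingType) (f : laurent C) :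
  euler C (lmon C 1 * f) = lmon C 1 * f + lmon C 1 * euler C f.
Proof.
rewrite -mulrDr.
apply: (@laurent_ext C _ (euler C \o lmul (lmon C 1))
  (lmul (lmon C 1) \o (idfun \+ euler C))) => {f} k /=.
rewrite lmul_mon !euler_lmon -[RHS]/(lmon C 1 * _) mulrDr -scalerAr -lmonD.
by rewrite intrD scalerDl scale1r.
Qed.

Lemma KopE (C : comNzRingType) (a b : C) (f : laurent C) :
  Kop a b f = euler C f +
    lmon C 1 * ((a + b + 1)%:A * lmon C 1 + (a - b)%:A) * M1_quot f.
Proof. by rewrite /Kop mulr_algl. Qed.

Lemma M1_quot_M1 (C : comNzRingType) (f : laurent C) :
  M1_quot (M1 f) = - M1_quot f.
Proof.
by apply/esym/M1_quot_unique; rewrite mulrN M1_quotE opprB M1K.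
Qed.

Lemma M1_M1_quot (C : comNzRingType) (f : laurent C) :
  M1 (M1_quot f) = lmon C 1 ^+ 2 * M1_quot f.
Proof.
have /(congr1 (@M1 C)) := M1_quotE f.
rewrite M1_mul expr2 linearB /= M1_mul -lmon_0 !M1_lmon oppr0 linearB /= M1K.
(* The factor z^2 clears the denominator of 1 - z^-2, the image of 1 - z^2 under [M1], and gives z^2
   - 1. *)
move=> /(congr1 (fun g => lmon C 1 ^+ 2 * g)) E.
apply: (@lreg_1subz2 C).
have -> : (1 - lmon C 1 ^+ 2) * (lmon C 1 ^+ 2 * M1_quot f) =
          lmon C 1 ^+ 2 * (M1 f - f) by rewrite -M1_quotE; ring.
rewrite -[M1 f - f]opprB mulrN -E lmon_0.
ring: (lmon1_lmonN1 C).
Qed.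

Lemma M1_quot_M2 (C : comNzRingType) (f : laurent C) :
  M1_quot (M2 f) = lmon C (-1) * (M1 f - M1_quot f).
Proof.
apply/esym/M1_quot_unique.
have -> : (1 - lmon C 1 ^+ 2) * (lmon C (-1) * (M1 f - M1_quot f)) =
  lmon C (-1) * ((1 - lmon C 1 ^+ 2) * M1 f - (1 - lmon C 1 ^+ 2) * M1_quot f)
  by ring.
rewrite M1_quotE /M2 M1_mul M1K M1_lmon.
(* What remains is z^-1 f - z [M1 f] = z^-1 ((1 - z^2) [M1 f] - ([M1 f] - f)). *)
ring: (lmon1_lmonN1 C).
Qed.

(** The z^2 produced by [M1_M1_quot] absorbs the negative powers in the reflected coefficient z^-1
    ((a + b + 1) z^-1 + a - b). *)
Lemma M1_Kop (C : comNzRingType) (a b : C) (f : laurent C) :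
  M1 (Kop a b f) = M1 (euler C f) +
    ((a + b + 1)%:A + (a - b)%:A * lmon C 1) * M1_quot f.
Proof.
rewrite KopE linearD /= (M1_mul _ (lmon C 1 * _)) M1_M1_quot M1_mul linearD /=.
rewrite (M1_mul _ (_ *: _)) !M1_alg M1_lmon; congr (_ + _).
ring: (lmon1_lmonN1 C).
Qed.

Lemma anticomm_Kop_M1 (C : comNzRingType) (a b : C) (f : laurent C) :
  anticomm (Kop a b) (@M1 C) f = (a + b + 1) *: (M1 f - f).
Proof.
rewrite /anticomm M1_Kop KopE euler_M1 M1_quot_M1.
(* The Euler terms and the a - b terms cancel, leaving (a + b + 1)(1 - z^2) times the quotient. *)
by rewrite -(mulr_algl (a + b + 1) (_ - _)) -M1_quotE; ring.
Qed.

(** The Euler terms leave one extra [M2 f] from the Leibniz rule, hence the last summand 1 of the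
    coefficient. *)
Lemma anticomm_Kop_M2 (C : comNzRingType) (a b : C) (f : laurent C) :
  anticomm (Kop a b) (@M2 C) f = (a + b + 1 + 1) *: M2 f + (a - b) *: f.
Proof.
rewrite /anticomm KopE M1_quot_M2 /M2 M1_Kop euler_lmon1M euler_M1.
rewrite [_ *: (_ * _)]scalerDl scale1r -(mulr_algl _ (lmon C 1 * _)).
rewrite -(mulr_algl _ f).
(* Eliminating the bare f on the right leaves only [M1 f] and the quotient, together with Euler
   terms that cancel. *)
have fE : f = M1 f - (1 - lmon C 1 ^+ 2) * M1_quot f.
  by rewrite M1_quotE opprB addrC subrK.
rewrite [X in _ = _ + _ * X]fE.
ring: (lmon1_lmonN1 C).
Qed.

Theorem mainTheorem3 (R : realType) (alpha beta : R) :
  let I : laurent R[i] -> laurent R[i] := id in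
  let M1 : laurent R[i] -> laurent R[i] := @M1 R[i] in
  let M2 : laurent R[i] -> laurent R[i] := @M2 R[i] in
  let K : laurent R[i] -> laurent R[i] := @Kop R[i] alpha%:C beta%:C in
  [/\ M1 \o M1 =1 I,
      M2 \o M2 =1 I,
      anticomm K M1 =1 fun f => (alpha + beta + 1)%:C *: (M1 f - I f)
    & anticomm K M2 =1 fun f =>
        (alpha + beta + 2)%:C *: M2 f + (alpha - beta)%:C *: I f].
Proof.
split=> f /=; first exact: M1K.
- exact: M2K.
- by rewrite anticomm_Kop_M1 !rmorphD rmorph1.
- by rewrite anticomm_Kop_M2 rmorphB !rmorphD rmorph1 !addrA.
Qed.
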